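(* Let $A\in\mathbb{R}^{d\times d}$ be symmetric and let $b\in\mathbb{R}^d$ be nonzero. Suppose that no unlucky breakdown occurs. Then the modified CG algorithm described in the context, applied to $(A,b)$ in exact arithmetic, returns $x^{+}=A^\dagger b$, where $A^\dagger$ is the Moore–Penrose pseudo-inverse of $A$.
   Context: Modified CG algorithm (conjugate gradient with pseudo-inverse solution). Input $A$, $b$. Set $k=1$, $x_0=x_0'=0$, $r_0=p_0=b$. While $\|Ap_{k-1}\|\neq0$ do: $\alpha_{k-1}=\langle r_{k-1},r_{k-1}\rangle/\langle p_{k-1},Ap_{k-1}\rangle$; $x_k=x_{k-1}+\alpha_{k-1}p_{k-1}$; $r_k=r_{k-1}-\alpha_{k-1}Ap_{k-1}$; $\beta_{k-1}=\langle r_k,r_k\rangle/\langle r_{k-1},r_{k-1}\rangle$; $p_k=r_k+\beta_{k-1}p_{k-1}$; $\gamma_{k-1}=\langle p_{k-1},p_{k-1}\rangle/\big(\langle r_{k-1},r_{k-1}\rangle\langle p_{k-1},Ap_{k-1}\rangle\big)$; $x_k'=x_{k-1}'+\gamma_{k-1}p_{k-1}$; $k\leftarrow k+1$. After the loop: if $\|p_{k-1}\|\neq0$, set $x^\star=x_{k-1}-\big(\|r_{k-1}\|^4/\|p_{k-1}\|^2\big)x_{k-1}'$ and $x^{+}=x^\star-\big(\langle p_{k-1},x^\star\rangle/\|p_{k-1}\|^2\big)p_{k-1}$; otherwise set $x^{+}=x_{k-1}$. Return $x^{+}$. No unlucky breakdown: if $A$ is indefinite, then no generated direction $p_{k-1}$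 is a zero-curvature direction, i.e. there is no generated nonzero $p_{k-1}\notin\mathrm{Null}(A)$ with $\langle p_{k-1},Ap_{k-1}\rangle=0$. *)

(* Defs.v *)
From mathcomp Require Import all_boot all_order all_algebra.
From mathcomp Require Import boolp classical_sets reals.

Set Implicit Arguments.
Unset Strict Implicit.
Unset Printing Implicit Defensive.

Import Order.TTheory GRing.Theory Num.Theory.

Local Open Scope ring_scope.
Local Open Scope classical_set_scope.

(* Euclidean inner product and norm on column vectors; MathComp-Analysis's
   canonical norm on matrices is the sup norm. *)
Definition dot (R : realType) (d : nat) (u v : 'cV[R]_d) : R :=
  \sum_(i < d) u i 0 * v i 0.

Definition enorm (R : realType) (d : nat) (u : 'cV[R]_d) : R :=
  Num.sqrt (dot u u).

Definition penrose (R : realType) (m n : nat)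
    (A : 'M[R]_(m, n)) (X : 'M[R]_(n, m)) : Prop :=
  [/\ A *m X *m A = A,
      X *m A *m X = X,
      (A *m X)^T = A *m X
    & (X *m A)^T = X *m A].

(* The unique solution of the Penrose equations (see mppinvP, penrose_uniq).
   MathComp's pinvmx satisfies only the first two of them in general. *)
Definition mppinv (R : realType) (m n : nat) (A : 'M[R]_(m, n)) :
  'M[R]_(n, m) := xget 0 [set X | penrose A X].

Lemma penrose_uniq (R : realType) (m n : nat) (A : 'M[R]_(m, n))
    (X Y : 'M[R]_(n, m)) : penrose A X -> penrose A Y -> X = Y.
Proof.
case=> [X1 X2 X3 X4] [Y1 Y2 Y3 Y4].
have eAX : A *m X = A *m Y.
  by rewrite -X3 -{1}Y1 -(mulmxA (A *m Y)) trmx_mul X3 Y3 mulmxA X1.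
have eXA : X *m A = Y *m A.
  rewrite -X4 -{1}Y1 -mulmxA mulmxA trmx_mul X4.
  by rewrite Y4 -mulmxA (mulmxA A X A) X1.
by rewrite -X2 eXA -mulmxA eAX mulmxA Y2.
Qed.

Lemma gram_unit (R : realType) (m n : nat) (F : 'M[R]_(m, n)) :
  row_free F -> F *m F^T \in unitmx.
Proof.
move=> Ffree; rewrite -row_free_unit; apply/inj_row_free => v vFF.
have sq0 : (v *m F *m (v *m F)^T) 0 0 = 0.
  by rewrite trmx_mul mulmxA -(mulmxA v) vFF mul0mx mxE.
have vF0 : v *m F = 0.
  apply/rowP => j; rewrite [RHS]mxE.
  move: sq0; rewrite mxE => /eqP; rewrite psumr_eq0; last first.
    by move=> i _; rewrite [X in _ * X]mxE -expr2 sqr_ge0.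
  move=> /allP /(_ j (mem_index_enum _)) /=.
  by rewrite [X in _ * X]mxE -expr2 sqrf_eq0 => /eqP.
by apply: (row_free_inj Ffree); rewrite vF0 mul0mx.
Qed.

Lemma penrose_ex (R : realType) (m n : nat) (A : 'M[R]_(m, n)) :
  exists X, penrose A X.
Proof.
have: exists r (C : 'M[R]_(m, r)) (F : 'M[R]_(r, n)),
    [/\ A = C *m F, row_full C & row_free F].
  exists (\rank A), (col_base A), (row_base A).
  by rewrite mulmx_base col_base_full row_base_free.
case=> r [C] [F] [AE Cfull Ffree].
have uF : F *m F^T \in unitmx by apply: gram_unit.
have uC : C^T *m C \in unitmx.
  by rewrite -{2}(trmxK C); apply: gram_unit; rewrite /row_free mxrank_tr.
pose P := F^T *m invmx (F *m F^T); pose Q := invmx (C^T *m C) *m C^T.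
have FP : F *m P = 1%:M by rewrite mulmxA mulmxV.
have QC : Q *m C = 1%:M by rewrite -mulmxA mulVmx.
have AX : A *m (P *m Q) = C *m Q by rewrite AE mulmxA -(mulmxA C) FP mulmx1.
have XA : P *m Q *m A = P *m F by rewrite AE mulmxA -(mulmxA P) QC mulmx1.
exists (P *m Q); split.
- by rewrite AX AE mulmxA -(mulmxA C) QC mulmx1.
- by rewrite XA mulmxA -(mulmxA P) FP mulmx1.
- by rewrite AX /Q !trmx_mul trmx_inv !trmx_mul !trmxK mulmxA.
- by rewrite XA /P !trmx_mul trmx_inv !trmx_mul !trmxK mulmxA.
Qed.

Lemma mppinvP (R : realType) (m n : nat) (A : 'M[R]_(m, n)) :
  penrose A (mppinv A).
Proof. exact: (xgetPex 0 (penrose_ex A)). Qed.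

Record cg_state (R : realType) (d : nat) := CGState {
  cg_x : 'cV[R]_d;
  cg_x' : 'cV[R]_d;
  cg_r : 'cV[R]_d;
  cg_p : 'cV[R]_d }.

Definition cg_init (R : realType) (d : nat) (b : 'cV[R]_d) : cg_state R d :=
  CGState 0 0 b b.

Definition cg_step (R : realType) (d : nat) (A : 'M[R]_d)
    (s : cg_state R d) : cg_state R d :=
  let: CGState x x' r p := s in
  let alpha := dot r r / dot p (A *m p) in
  let x1 := x + alpha *: p in
  let r1 := r - alpha *: (A *m p) in
  let beta := dot r1 r1 / dot r r in
  let p1 := r1 + beta *: p in
  let gamma := dot p p / (dot r r * dot p (A *m p)) in
  let x1' := x' + gamma *: p in
  CGState x1 x1' r1 p1.

(* The states at the successive tests of the loop condition.  Since division
   is total (y / 0 = 0), the body is executed only if its divisors are nonzero;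
   a run that would divide by zero is stuck and returns nothing. *)
Inductive cg_reached (R : realType) (d : nat) (A : 'M[R]_d) (b : 'cV[R]_d) :
    cg_state R d -> Prop :=
| cg_reached_init : cg_reached A b (cg_init b)
| cg_reached_step (s : cg_state R d) :
    cg_reached A b s ->
    enorm (A *m cg_p s) != 0 ->
    dot (cg_r s) (cg_r s) != 0 ->
    dot (cg_p s) (A *m cg_p s) != 0 ->
    cg_reached A b (cg_step A s).

Definition cg_output (R : realType) (d : nat) (s : cg_state R d) : 'cV[R]_d :=
  let: CGState x x' r p := s in
  if enorm p != 0 then
    let xstar := x - (enorm r ^+ 4 / enorm p ^+ 2) *: x' in
    xstar - (dot p xstar / enorm p ^+ 2) *: p
  else x.

Definition cg_returns (R : realType) (d : nat) (A : 'M[R]_d) (b : 'cV[R]_d)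
    (y : 'cV[R]_d) : Prop :=
  exists s : cg_state R d,
    [/\ cg_reached A b s, enorm (A *m cg_p s) = 0 & cg_output s = y].

Lemma cg_returns_uniq (R : realType) (d : nat) (A : 'M[R]_d)
    (b y z : 'cV[R]_d) : cg_returns A b y -> cg_returns A b z -> y = z.
Proof.
pose st k := iter k (cg_step A) (cg_init b).
have reachE s : cg_reached A b s -> exists2 k, s = st k &
    forall i, (i < k)%N -> enorm (A *m cg_p (st i)) != 0.
  elim=> [|{}s _ [k -> lt_k] Ap _ _]; first by exists 0%N.
  exists k.+1 => // i; rewrite ltnS leq_eqVlt => /predU1P[-> //|].
  exact: lt_k.
case=> s [/reachE[k -> lt_k] Ak <-] [t [/reachE[l -> lt_l] Al <-]].
case: (ltngtP k l) => [kl|lk|-> //].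
- by move: (lt_l k kl); rewrite Ak eqxx.
- by move: (lt_k l lk); rewrite Al eqxx.
Qed.

Definition indefinite (R : realType) (d : nat) (A : 'M[R]_d) : Prop :=
  (exists u : 'cV[R]_d, 0 < dot u (A *m u)) /\
  (exists v : 'cV[R]_d, dot v (A *m v) < 0).

Definition no_unlucky_breakdown (R : realType) (d : nat) (A : 'M[R]_d)
    (b : 'cV[R]_d) : Prop :=
  indefinite A ->
  ~ exists s : cg_state R d,
      [/\ cg_reached A b s, cg_p s != 0, A *m cg_p s != 0
        & dot (cg_p s) (A *m cg_p s) = 0].

(* Main.v *)
Require Import Defs.
From mathcomp Require Import all_boot all_order all_algebra.
From mathcomp Require Import boolp reals ring.

Import Order.TTheory GRing.Theory Num.Theory.
Local Open Scope ring_scope.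

(** Two facts are needed: the loop stops, and the state in which it stops is
    turned into [A^+ b] by the final correction.

    Stopping is the conjugacy property of CG.  The span [U] of the directions
    used so far satisfies [r _|_ U], [A p _|_ U], [p - r \in U] and
    [A U <= U + <p>], and these four relations pass from [U] to [U + <p>]
    without reference to the individual directions ([cg_step_conjugate]).
    Since [A p _|_ U] while [<p, A p> != 0], the dimension of [U] grows at each
    step, so there are at most [d] steps ([cg_terminates]).  No step gets stuck
    either: [r = 0] entails [p = 0], hence [A p = 0]; as for [<p, A p> = 0], it
    forces [A p = 0] if [A] is not indefinite ([semidef_isotropic]), and the
    absence of breakdown covers the indefinite case.

    Correctness only uses relations between consecutive iterates.  With
    [rho_i = |r_i|^2], the recurrence for [p] reads
    [p_k / rho_k = r_k / rho_k + p_(k-1) / rho_(k-1)], so that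
    [p_k / rho_k = \sum_(i <= k) r_i / rho_i] and, by orthogonality,
    [|p_k|^2 / rho_k^2 = \sum_(i <= k) 1 / rho_i].  The steps
    of [x'] are those of [x] multiplied by [|p_i|^2 / rho_i^2]; as the steps of
    [x] satisfy [A (x_(i+1) - x_i) = r_i - r_(i+1)], summation by parts gives
    [A x' = p / rho - (|p|^2 / rho^2) r].  Hence [b - A x* = (rho / |p|^2) p]:
    when [A p = 0], [x*] is a least-squares solution.  All the iterates lie in
    [<b> + Im A], which equals [<p> + Im A] when the loop stops with [p != 0];
    [Im A] is orthogonal to [p], so that removing from [x*] its component
    along [p] puts it in [Im A].  A least-squares solution in [Im A]
    is [A^+ b] ([mppinv_sym_unique]). *)

(** * The inner product *)

Section InnerProduct.
Context {R : realType} {d : nat}.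
Implicit Types (u v w : 'cV[R]_d) (A : 'M[R]_d).

Lemma dotE u v : dot u v = (u^T *m v) 0 0.
Proof. by rewrite mxE; apply: eq_bigr => i _; rewrite mxE. Qed.

Lemma dotC u v : dot u v = dot v u.
Proof. by apply: eq_bigr => i _; rewrite mulrC. Qed.

Lemma dotDr u v w : dot u (v + w) = dot u v + dot u w.
Proof. by rewrite !dotE mulmxDr mxE. Qed.

Lemma dotZr a u v : dot u (a *: v) = a * dot u v.
Proof. by rewrite !dotE -scalemxAr mxE. Qed.

Lemma dotNr u v : dot u (- v) = - dot u v.
Proof. by rewrite -scaleN1r dotZr mulN1r. Qed.

Lemma dotDl u v w : dot (u + v) w = dot u w + dot v w.
Proof. by rewrite dotC dotDr !(dotC w). Qed.

Lemma dotZl a u v : dot (a *: u) v = a * dot u v.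
Proof. by rewrite dotC dotZr dotC. Qed.

Lemma dotNl u v : dot (- u) v = - dot u v.
Proof. by rewrite dotC dotNr dotC. Qed.

Definition dot_linE := (dotDl, dotDr, dotZl, dotZr, dotNl, dotNr).

Lemma dot0r u : dot u 0 = 0.
Proof. by rewrite dotE mulmx0 mxE. Qed.

Lemma dot_sym A u v : A^T = A -> dot u (A *m v) = dot (A *m u) v.
Proof. by move=> sA; rewrite !dotE trmx_mul sA mulmxA. Qed.

Lemma dot_mx0 u v : u^T *m v = 0 <-> dot u v = 0.
Proof.
rewrite dotE; split=> [->|uv0]; first by rewrite mxE.
by apply/matrixP => i j; rewrite !ord1 uv0 mxE.
Qed.

Lemma dot_ge0 u : 0 <= dot u u.
Proof. by apply: sumr_ge0 => i _; rewrite -expr2 sqr_ge0. Qed.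

Lemma dot_eq0 u : (dot u u == 0) = (u == 0).
Proof.
apply/eqP/eqP => [|->]; last exact: dot0r.
move/eqP; rewrite psumr_eq0 => [|i _]; last by rewrite -expr2 sqr_ge0.
move=> /allP u0; apply/colP => i; rewrite mxE.
by have := u0 i (mem_index_enum _); rewrite /= -expr2 sqrf_eq0 => /eqP.
Qed.

Lemma enorm_sqr u : enorm u ^+ 2 = dot u u.
Proof. by rewrite sqr_sqrtr // dot_ge0. Qed.

Lemma enorm_eq0 u : (enorm u == 0) = (u == 0).
Proof. by rewrite -sqrf_eq0 enorm_sqr dot_eq0. Qed.

End InnerProduct.

(** * Semidefinite matrices *)

(** Otherwise the quadratic form would change sign along the line
    [v + t A v]: its derivative at [t = 0] is [2 |A v|^2]. *)
Lemma psd_isotropic {R : realType} {d : nat} (A : 'M[R]_d) (v : 'cV[R]_d) :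
  A^T = A -> (forall u : 'cV[R]_d, 0 <= dot u (A *m u)) ->
  dot v (A *m v) = 0 -> A *m v = 0.
Proof.
move=> sA psd vAv; apply/eqP; rewrite -dot_eq0.
set q := A *m v in vAv *; set n := dot q q; set c := dot q (A *m q).
have c0 : 0 <= c by exact: psd.
have c1 : c + 1 != 0 by rewrite gt_eqF // ltr_wpDl.
(* The minimiser is [- n / c]; adding 1 keeps the divisor nonzero. *)
pose t := - n / (c + 1).
have := psd (v + t *: q).
rewrite mulmxDr -scalemxAr !dot_linE -/q vAv -/c -/n.
rewrite (dot_sym A v q sA) -/q -/n.
have -> : 0 + t * n + (t * n + t * (t * c)) =
    - ((n / (c + 1)) ^+ 2 * (c + 2)).
  by rewrite /t; field.
rewrite oppr_ge0 pmulr_lle0; last by rewrite ltr_wpDl.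
by rewrite exprn_even_le0 //= mulf_eq0 invr_eq0 (negPf c1) orbF.
Qed.

Lemma semidef_isotropic {R : realType} {d : nat} (A : 'M[R]_d)
    (v : 'cV[R]_d) :
  A^T = A -> ~ indefinite A -> dot v (A *m v) = 0 -> A *m v = 0.
Proof.
move=> sA nindef vAv.
have [[u upos]|npos] := pselect (exists u : 'cV[R]_d, 0 < dot u (A *m u)).
  apply: psd_isotropic => // w; rewrite leNgt; apply/negP => wneg.
  by apply: nindef; split; [exists u|exists w].
have : (- A) *m v = 0.
  apply: psd_isotropic => [|w|]; first by rewrite linearN /= sA.
    rewrite mulNmx dotNr oppr_ge0 leNgt; apply/negP => wpos.
    by apply: npos; exists w.
  by rewrite mulNmx dotNr vAv oppr0.
by rewrite mulNmx => /eqP; rewrite oppr_eq0 => /eqP.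
Qed.

(** * The pseudo-inverse of a symmetric matrix *)

(** For symmetric [A], [A^+] kills [ker A] and [A^+ A] is the identity
    on [Im A]. *)
Lemma mppinv_sym_unique {R : realType} {d : nat} (A : 'M[R]_d)
    (b w : 'cV[R]_d) :
  A^T = A -> A *m (b - A *m (A *m w)) = 0 -> A *m w = mppinv A *m b.
Proof.
move=> sA; set X := mppinv A; set n := b - _ => An0.
have [P1 P2 P3 P4] : penrose A X by exact: mppinvP.
have Xn0 : X *m n = 0.
  by rewrite -P2 -(mulmxA X) -P3 trmx_mul sA -!mulmxA An0 !mulmx0.
have XAA : X *m A *m A = A.
  by rewrite -P4 -{2}sA -trmx_mul mulmxA P1.
have -> : b = n + A *m (A *m w) by rewrite subrK.
by rewrite mulmxDr Xn0 add0r !mulmxA XAA.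
Qed.

(** * Correctness of the returned vector *)

Section Correctness.
Context {R : realType} {d : nat} (A : 'M[R]_d) (b : 'cV[R]_d).

(** A coarse substitute for the Krylov spaces of [(A, b)], all of which lie in
    [<b> + Im A]: no degree has to be tracked. *)
Definition krylov (v : 'cV[R]_d) : Prop := exists a z, v = a *: b + A *m z.

Lemma krylov0 : krylov 0.
Proof. by exists 0, 0; rewrite scale0r mulmx0 addr0. Qed.

Lemma krylovb : krylov b.
Proof. by exists 1, 0; rewrite scale1r mulmx0 addr0. Qed.

Lemma krylov_res x : krylov (b - A *m x).
Proof. by exists 1, (- x); rewrite scale1r mulmxN. Qed.

Lemma krylov_lin c u v : krylov u -> krylov v -> krylov (u + c *: v).
Proof.
move=> [a [z ->]] [a' [z' ->]]; exists (a + c * a'), (z + c *: z').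
rewrite mulmxDr -scalemxAr scalerDl scalerDr scalerA -!addrA; congr (_ + _).
by rewrite addrCA.
Qed.

(** [cg_Ax'] is the closed form of the sum that [x'] accumulates; it needs
    [r != 0], which can only fail in the last state. *)
Record cg_local (s : cg_state R d) : Prop := CGLocal {
  cg_res : cg_r s = b - A *m cg_x s;
  cg_rp : dot (cg_r s) (cg_p s) = dot (cg_r s) (cg_r s);
  cg_r0p0 : dot (cg_r s) (cg_r s) = 0 -> cg_p s = 0;
  cg_Ax' : dot (cg_r s) (cg_r s) != 0 ->
    A *m cg_x' s = (dot (cg_r s) (cg_r s))^-1 *: cg_p s
      - (dot (cg_p s) (cg_p s) / dot (cg_r s) (cg_r s) ^+ 2) *: cg_r s;
  cg_krylov_x : krylov (cg_x s);
  cg_krylov_x' : krylov (cg_x' s);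
  cg_krylov_p : krylov (cg_p s) }.

Lemma cg_local_init : cg_local (cg_init b).
Proof.
split=> //=; [| |move=> b0| | |].
- by rewrite mulmx0 subr0.
- by move/eqP; rewrite dot_eq0 => /eqP.
- by rewrite mulmx0 expr2 invfM mulrA divff // mul1r subrr.
- exact: krylov0.
- exact: krylov0.
- exact: krylovb.
Qed.

Lemma cg_local_step s : dot (cg_r s) (cg_r s) != 0 ->
  dot (cg_p s) (A *m cg_p s) != 0 -> cg_local s -> cg_local (cg_step A s).
Proof.
case: s => x x' r p /= rho0 pAp0 [/= res rp _ Ax' Kx Kx' Kp].
have {}Ax' := Ax' rho0.
set alpha := dot r r / _; set r1 := r - _; set beta := dot r1 r1 / _.
have r1p : dot r1 p = 0.
  by rewrite /r1 !dot_linE rp (dotC _ p) /alpha divfK // subrr.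
have res1 : r1 = b - A *m (x + alpha *: p).
  by rewrite /r1 res mulmxDr -scalemxAr opprD addrA.
have Kp1 : krylov (r1 + beta *: p).
  by apply: krylov_lin => //; rewrite res1; apply: krylov_res.
(* The step of [x'] is the step of [x] times [|p|^2 / |r|^4]. *)
have gAp : (dot p p / (dot r r * dot p (A *m p))) *: (A *m p) =
    (dot p p / dot r r ^+ 2) *: (r - r1).
  rewrite /r1 opprB addrC subrK scalerA; congr (_ *: _).
  by rewrite /alpha; field; apply/andP.
clearbody r1; split=> //=.
- by rewrite dotDr dotZr r1p mulr0 addr0.
- move=> r10; rewrite /beta r10 mul0r scale0r addr0.
  by apply/eqP; rewrite -dot_eq0 r10.
- move=> rho10.
  have pp1 : dot (r1 + beta *: p) (r1 + beta *: p) =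
      dot r1 r1 + beta ^+ 2 * dot p p.
    by rewrite dotDr dotZr !dotDl !dotZl (dotC p) r1p; ring.
  rewrite mulmxDr -scalemxAr gAp Ax' pp1 /beta.
  by apply/colP => i; rewrite !mxE; field; apply/andP.
- exact: krylov_lin.
- exact: krylov_lin.
Qed.

Lemma cg_reached_local s : cg_reached A b s -> cg_local s.
Proof.
elim=> [|{}s _ IH _ r0 pAp]; first exact: cg_local_init.
exact: cg_local_step.
Qed.

(** When [p != 0], [p] spans the component of [b] in [ker A], so the
    component of [x*] outside [Im A] is exactly the one along [p]. *)
Lemma cg_output_correct s : A^T = A -> cg_local s -> A *m cg_p s = 0 ->
  cg_output s = mppinv A *m b.
Proof.
move=> sA; case: s => x x' r p [/= res rp r0p0 Ax' Kx Kx' _] Ap0.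
rewrite enorm_eq0; case: eqVneq => [p0|p0] /=.
  have bE : b = A *m x.
    apply/eqP; rewrite -subr_eq0 -res -dot_eq0 -rp p0.
    by rewrite dot0r.
  have [a [z xE]] := Kx.
  have {}xE : x = A *m (a *: x + z) by rewrite mulmxDr -scalemxAr -bE.
  by rewrite {1}xE; apply: mppinv_sym_unique; rewrite // -xE -bE subrr mulmx0.
have rho0 : dot r r != 0 by apply: contra_neq p0.
have pp0 : dot p p != 0 by rewrite dot_eq0.
rewrite (exprM _ 2 2) !enorm_sqr.
set xs := x - _.
have [a [z xsE]] : krylov xs by rewrite /xs -scaleNr; apply: krylov_lin.
pose c := dot r r / dot p p.
have bE : b = c *: p + A *m xs.
  rewrite /xs mulmxBr -scalemxAr (Ax' rho0) scalerBr !scalerA.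
  have -> : dot r r ^+ 2 / dot p p / dot r r = c.
    by rewrite /c; field; apply/andP.
  have -> : dot r r ^+ 2 / dot p p * (dot p p / dot r r ^+ 2) = 1.
    by field; apply/andP.
  by rewrite scale1r res opprB addrCA subrKC addrC subrK.
clearbody xs; pose w := a *: xs + z.
have {}xsE : xs = (a * c) *: p + A *m w.
  by rewrite {1}xsE {1}bE /w mulmxDr -scalemxAr scalerDr scalerA addrA.
have pxs : dot p xs = a * c * dot p p.
  by rewrite xsE !dot_linE (dot_sym _ _ _ sA) Ap0 dotC dot0r addr0.
clearbody w; rewrite pxs mulfK // {1}xsE addrC addKr.
apply: mppinv_sym_unique => //.
have <- : A *m xs = A *m (A *m w).
  by rewrite xsE mulmxDr -scalemxAr Ap0 scaler0 add0r.
by rewrite {1}bE addrK -scalemxAr Ap0 scaler0.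
Qed.

End Correctness.

(** * Termination *)

Section Termination.
Context {R : realType} {d : nat} (A : 'M[R]_d) (b : 'cV[R]_d).

(** [U] stands for the span of the previous directions, as the row space of a
    square matrix so that its type does not change as directions are added. *)
Record conjugate_to (U : 'M[R]_d) (r p : 'cV[R]_d) : Prop := ConjugateTo {
  conj_r : U *m r = 0;
  conj_Ap : U *m (A *m p) = 0;
  conj_pr : ((p - r)^T <= U)%MS;
  conj_AU : (U *m A <= U + p^T)%MS }.

(** What makes [A p1] orthogonal to all of [U], rather than to [p] alone, is
    [A U <= U + <p>]: for [u] in [U], [<A p1, u> = <r1, A u> + beta <A p, u>],
    and [r1] is orthogonal to [U + <p>].  The inclusion is preserved
    because [A p] is a multiple of [r - r1], where [r] lies in [U + <p>] and
    [r1] in [<p1> + <p>]. *)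
Lemma cg_step_conjugate (U : 'M[R]_d) s : A^T = A ->
  dot (cg_r s) (cg_p s) = dot (cg_r s) (cg_r s) ->
  dot (cg_r s) (cg_r s) != 0 -> dot (cg_p s) (A *m cg_p s) != 0 ->
  conjugate_to U (cg_r s) (cg_p s) ->
  conjugate_to (U + (cg_p s)^T)%MS
    (cg_r (cg_step A s)) (cg_p (cg_step A s)).
Proof.
move=> sA; case: s => x x' r p /= rp rho0 pAp0 [Ur UAp pr AU].
set alpha := dot r r / _; set r1 := r - _; set beta := dot r1 r1 / _.
have alpha0 : alpha != 0 by rewrite /alpha mulf_neq0 ?invr_eq0.
set V := (U + p^T)%MS.
have VP (v : 'cV[R]_d) : U *m v = 0 -> dot p v = 0 -> V *m v = 0.
  move=> Uv /dot_mx0 pv; apply/sub_kermxP.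
  by rewrite addsmx_sub; apply/andP; split; apply/sub_kermxP.
have pV : (p^T <= V)%MS := addsmxSr _ _.
have rV : (r^T <= V)%MS.
  have -> : r^T = p^T - (p - r)^T by rewrite -linearB /= opprB addrC subrK.
  by rewrite addmx_sub // eqmx_opp (submx_trans pr (addsmxSl _ _)).
have Vr1 : V *m r1 = 0.
  apply: VP; first by rewrite mulmxBr -scalemxAr Ur UAp scaler0 subrr.
  by rewrite !dot_linE (dotC _ r) rp /alpha divfK // subrr.
have ApE : A *m p = alpha^-1 *: (r - r1).
  by rewrite /r1 opprB addrC subrK scalerA mulVf ?scale1r.
have rr1 : dot r r1 = 0.
  by apply/dot_mx0; have /submxP[D ->] := rV; rewrite -mulmxA Vr1 mulmx0.
clearbody r1; split.
- exact: Vr1.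
- apply: VP.
  + have /submxP[D UAE] : (U *m A <= V)%MS by [].
    rewrite mulmxDr -scalemxAr mulmxDr -scalemxAr UAp scaler0 addr0.
    by rewrite mulmxA UAE -mulmxA Vr1 mulmx0.
  + rewrite mulmxDr -scalemxAr dotDr dotZr (dot_sym _ p r1 sA) {1}ApE.
    rewrite !dot_linE rr1 add0r /beta /alpha invfM invrK.
    by field.
- by rewrite addrC addKr linearZ /= scalemx_sub.
- set p1 := r1 + beta *: p.
  have VW : (V <= V + p1^T)%MS := addsmxSl _ _.
  have p1W : (p1^T <= V + p1^T)%MS := addsmxSr _ _.
  rewrite addsmxMr addsmx_sub (submx_trans AU VW) /=.
  rewrite -{1}sA -trmx_mul ApE linearZ /= scalemx_sub // linearB /=.
  rewrite addmx_sub ?(submx_trans rV VW) // eqmx_opp.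
  have -> : r1^T = p1^T - beta *: p^T.
    by rewrite -linearZ -linearB /= /p1 addrK.
  rewrite addmx_sub // eqmx_opp scalemx_sub //.
  exact: submx_trans pV VW.
Qed.

Lemma conjugate_rank (U : 'M[R]_d) r p : dot p (A *m p) != 0 ->
  conjugate_to U r p -> (\rank U < \rank (U + p^T)%MS)%N.
Proof.
move=> pAp0 [_ UAp _ _]; apply: rank_ltmx.
rewrite /ltmx addsmxSl /=; apply: contraNN pAp0 => /(submx_trans (addsmxSr _ _)).
by case/submxP => D pE; apply/eqP/dot_mx0; rewrite pE -mulmxA UAp mulmx0.
Qed.

Lemma cg_terminates : A^T = A -> no_unlucky_breakdown A b ->
  exists2 s, cg_reached A b s & A *m cg_p s = 0.
Proof.
move=> sA nobreak.
have grow n : (exists2 s, cg_reached A b s & A *m cg_p s = 0) \/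
    exists s U, [/\ cg_reached A b s, conjugate_to U (cg_r s) (cg_p s)
                  & (n <= \rank U)%N].
  elim: n => [|n [|[s [U [reach conj leU]]]]]; [right|by left|].
    exists (cg_init b), 0; split; [exact: cg_reached_init| |by []].
    by split; rewrite /= ?mul0mx ?subrr ?trmx0 ?sub0mx.
  have [Ap0|Ap0] := eqVneq (A *m cg_p s) 0; [by left; exists s|right].
  have [_ rp r0p0 _ _ _ _] := cg_reached_local _ _ _ reach.
  have rho0 : dot (cg_r s) (cg_r s) != 0.
    by apply: contra_neq Ap0 => /r0p0 ->; rewrite mulmx0.
  have pAp0 : dot (cg_p s) (A *m cg_p s) != 0.
    have [indef|nindef] := pselect (indefinite A).
      apply/eqP => pAp; apply: (nobreak indef); exists s; split=> //.
      by apply: contra_neq Ap0 => ->; rewrite mulmx0.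
    by apply: contra_neq Ap0; apply: semidef_isotropic.
  exists (cg_step A s), (U + (cg_p s)^T)%MS; split.
  - by apply: cg_reached_step; rewrite ?enorm_eq0.
  - exact: cg_step_conjugate.
  - exact: leq_ltn_trans leU (conjugate_rank _ _ _ pAp0 conj).
have [//|[s [U [_ _]]]] := grow d.+1.
by rewrite ltnNge rank_leq_row.
Qed.

End Termination.

Theorem theorem2 (R : realType) (d : nat) (A : 'M[R]_d) (b : 'cV[R]_d)
    (symA : A^T = A) (b_neq0 : b != 0) (nobreak : no_unlucky_breakdown A b) :
  cg_returns A b (mppinv A *m b).
Proof.
have [s reach Ap0] := cg_terminates A b symA nobreak.
exists s; split=> //; first by apply/eqP; rewrite enorm_eq0 Ap0.
by apply: cg_output_correct => //; apply: cg_reached_local.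
Qed.
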